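(* Let $G$ be a Hausdorff 3-oscillating paratopological group. Then $G$ is $\flat$-separated. If, moreover, $G$ is regular, then $G$ is also $\flat$-regular.
   Context: A paratopological group is a pair $(G,\tau)$ where $G$ is a group and $\tau$ is a topology on $G$ making the group operation $G\times G\to G$ continuous; if inversion is also continuous it is a topological group (no separation axiom is assumed). For a paratopological group $(G,\tau)$, $\tau_\flat$ denotes the strongest topology on $G$ that is weaker than (contained in) $\tau$ and makes $G$ a topological group; $G^\flat=(G,\tau_\flat)$ is the group reflexion of $G$. $G$ is $\flat$-separated if $G^\flat$ is Hausdorff. A subset of $G$ is $\flat$-closed if it is closed in $\tau_\flat$. $G$ is $\flat$-regular if each neighborhood (in $\tau$) of the unit $e$ contains a neighborhood (in $\tau$) of $e$ which is $\flat$-closed. For a subset $U$ of a group put $(\pm U)^n=UU^{-1}U\cdots U^{(-1)^{n-1}}$ ($n$ alternating factors, starting with $U$). $G$ is 3-oscillating if there is a positive integer $n\le 3$ such that for any neighborhood $U$ of $e$ in $G$ the set $(\pm U)^n$ is a neighborhood of $e$ in $G^\flat$; equivalently, for any neighborhood $U$ of $e$ there is a neighborhood $V$ of $e$ in $G$ with $V^{-1}VV^{-1}\subset UU^{-1}U$. *)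

(* Defs.v *)
From HB Require Import structures.
From mathcomp Require Import all_boot all_classical topology.

Set Implicit Arguments.
Unset Strict Implicit.
Unset Printing Implicit Defensive.

Local Open Scope classical_set_scope.
Local Open Scope group_scope.

HB.structure Definition PreTopologicalGroup :=
  {G of Topological G & Group G}.

HB.mixin Record PreTopologicalGroup_isParatopologicalGroup G
    & PreTopologicalGroup G := {
  mulg_continuous : continuous (fun p : G * G => p.1 * p.2)
}.

#[short(type="paratopologicalGroupType")]
HB.structure Definition ParatopologicalGroup :=
  {G of PreTopologicalGroup G & PreTopologicalGroup_isParatopologicalGroup G}.

HB.mixin Record ParatopologicalGroup_isTopologicalGroup G
    & ParatopologicalGroup G := {
  invg_continuous : continuous (fun x : G => x^-1)
}.

#[short(type="topologicalGroupType")]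
HB.structure Definition TopologicalGroup :=
  {G of ParatopologicalGroup G & ParatopologicalGroup_isTopologicalGroup G}.

(* [t] ranges over all topologies on the carrier of [G]; the group operations
   are those of [G], the product topology is that of [t]. *)
Definition is_group_topology (G : groupType) (t : Topological G) :=
  let T := Topological.Pack t in
  continuous ((fun p => (p.1 : G) * (p.2 : G)) : T * T -> T) /\
  continuous ((fun x => (x : G)^-1) : T -> T).

Definition coarser_topology (T : topologicalType) (t : Topological T) :=
  @open (Topological.Pack t) `<=` @open T.

(* The group reflexion: the carrier of [G] with the supremum of all the group
   topologies contained in the topology of [G]. The lemmas below show that this
   supremum is itself such a topology, hence the strongest one. *)
Definition group_reflexion (G : paratopologicalGroupType) : Type :=
  sup_topology (fun t : {t : Topological G |
    is_group_topology t /\ coarser_topology t} => sval t).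

Section group_reflexion_instances.
Variable G : paratopologicalGroupType.

HB.instance Definition _ := Topological.on (group_reflexion G).
HB.instance Definition _ := Group.copy (group_reflexion G) G.
Local Notation H := (group_reflexion G).

Lemma nbhs_reflexion_sub
    (t : {t : Topological G | is_group_topology t /\ coarser_topology t})
    (x : H) :
  nbhs x --> (x : Topological.Pack (sval t)).
Proof. by apply: (iffLR (cvg_sup _ _ _)). Qed.

Let reflexion_mulg_continuous : continuous (fun p : H * H => p.1 * p.2).
Proof.
move=> [x y]; apply/cvg_sup => t.
have [[mt _] _] := svalP t.
apply: cvg_trans (mt (x, y)); apply: cvg_app.
move=> A [[B C] /= [Bx Cy] BCA]; exists (B, C) => //=.
split; first exact: (nbhs_reflexion_sub (t := t)).
exact: (nbhs_reflexion_sub (t := t)).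
Qed.

HB.instance Definition _ :=
  PreTopologicalGroup_isParatopologicalGroup.Build H reflexion_mulg_continuous.

Let reflexion_invg_continuous : continuous (fun x : H => x^-1).
Proof.
move=> x; have F : Filter (y^-1 @[y --> x]) by apply: fmap_filter; exact: (@nbhs_filter H x).
apply/cvg_sup => t; have [[_ vt] _] := svalP t.
by apply: cvg_trans (vt x); apply: cvg_app; exact: (nbhs_reflexion_sub (t := t)).
Qed.

HB.instance Definition _ :=
  ParatopologicalGroup_isTopologicalGroup.Build H reflexion_invg_continuous.

End group_reflexion_instances.

Lemma open_group_reflexion (G : paratopologicalGroupType) :
  @open (group_reflexion G) `<=` @open G.
Proof.
suff c : continuous (fun x : G => (x : group_reflexion G)).
  by move=> A oA; move/continuousP: c => /(_ A oA).
move=> x; apply/cvg_sup => t A; rewrite !nbhsE => -[B [oB Bx] BA].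
by exists B => //; split => //; have [_] := svalP t; apply.
Qed.

Lemma group_reflexion_strongest (G : paratopologicalGroupType)
    (t : Topological G) :
  is_group_topology t -> coarser_topology t ->
  @open (Topological.Pack t) `<=` @open (group_reflexion G).
Proof.
move=> gt ct A oA; rewrite openE => x Ax.
apply: (nbhs_reflexion_sub (t := exist _ t (conj gt ct))).
exact: (@open_nbhs_nbhs (Topological.Pack t)).
Qed.

Definition set_mulg (G : groupType) (A B : set G) : set G :=
  [set x * y | x in A & y in B].

Definition set_invg (G : groupType) (A : set G) : set G := [set x^-1 | x in A].

(* (±U)^n = U U^-1 U ... with n alternating factors, the first one being U *)
Fixpoint alternating_power (G : groupType) (U : set G) (n : nat) : set G :=
  if n is m.+1 then
    set_mulg (alternating_power U m) (if odd m then set_invg U else U)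
  else [set 1].

Definition oscillating (k : nat) (G : paratopologicalGroupType) :=
  exists2 n : nat, (0 < n <= k)%N &
    forall U : set G, nbhs (1 : G) U ->
      nbhs (1 : group_reflexion G) (alternating_power U n).

Definition flat_separated (G : paratopologicalGroupType) :=
  hausdorff_space (group_reflexion G).

Definition flat_closed (G : paratopologicalGroupType) (A : set G) :=
  closed (A : set (group_reflexion G)).

Definition flat_regular (G : paratopologicalGroupType) :=
  forall U : set G, nbhs (1 : G) U ->
    exists V : set G, [/\ nbhs (1 : G) V, flat_closed V & V `<=` U].

(* Main.v *)
Require Import Defs.
From mathcomp Require Import all_boot all_classical topology.

(** The key fact is that, in a 3-oscillating paratopological group, the closure
of a set [A] in the group reflexion lies in the original closure of [V A V],
for each neighborhood [V] of the unit ([closure_reflexion_sub]). Indeed the sets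
[W W^-1 W] are neighborhoods of the unit in the reflexion, so if [x] is in the
closure of [A] there, then [y^-1 x = a b^-1 c] for some [y] in [A] and [a], [b],
[c] in [W]. Solving for [b] gives

  [x b = (x c x^-1) y a].

The left-hand side is close to [x] in the original topology. The point [x] is
fixed before [W] is chosen, so the conjugate [x c x^-1] may be assumed to lie in
[V], although conjugation is not uniformly continuous; hence the right-hand side
lies in [V A V].

For [A] the singleton of the unit, this shows that a point which the reflexion
does not separate from the unit lies in the original closure of every [V V],
hence is the unit as soon as the original topology is Hausdorff. For [A = V], it
shows that the closure of [V] in the reflexion lies in the original closure of
[V V V], and regularity makes the latter arbitrarily small. *)

Set Implicit Arguments.
Unset Strict Implicit.
Unset Printing Implicit Defensive.

Local Open Scope classical_set_scope.
Local Open Scope group_scope.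

Lemma cvg_mulg (G : paratopologicalGroupType) (T : Type) (F : set_system T)
    (f g : T -> G) (a b : G) {FF : Filter F} :
  f @ F --> a -> g @ F --> b -> (f x * g x) @[x --> F] --> a * b.
Proof.
apply: continuous2_cvg; exact: (mulg_continuous (a, b)).
Qed.

Lemma cvg_mulVg (G : topologicalGroupType) (T : Type) (F : set_system T)
    (f g : T -> G) (a b : G) {FF : Filter F} :
  f @ F --> a -> g @ F --> b -> ((f x)^-1 * g x) @[x --> F] --> a^-1 * b.
Proof.
move=> fa gb; apply: cvg_mulg => //.
exact: (cvg_comp _ _ fa (invg_continuous a)).
Qed.

Lemma nbhs1_mulg2 (G : paratopologicalGroupType) (U : set G) :
  nbhs (1 : G) U -> exists2 V : set G, nbhs (1 : G) V &
    forall a b, V a -> V b -> U (a * b).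
Proof.
rewrite -{1}(mulg1 1) => /(mulg_continuous (1, 1)) [[A B] /= [A1 B1] ABU].
exists (A `&` B); first exact: filterI.
by move=> a b [Aa _] [_ Bb]; apply: (ABU (a, b)).
Qed.

Lemma nbhs1_mulg3 (G : paratopologicalGroupType) (U : set G) :
  nbhs (1 : G) U -> exists2 V : set G, nbhs (1 : G) V &
    forall a b c, V a -> V b -> V c -> U (a * b * c).
Proof.
move=> /nbhs1_mulg2 [V V1 VU]; have [W W1 WV] := nbhs1_mulg2 V1.
exists (V `&` W); first exact: filterI.
by move=> a b c [_ Wa] [_ Wb] [Vc _]; apply: VU => //; apply: WV.
Qed.

(** As the unit lies in [U], shorter alternating products are contained in the
longer ones, so the number of factors may be taken to be exactly 3. *)
Lemma oscillating3_nbhs (G : paratopologicalGroupType) (U : set G) :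
  oscillating 3 G -> nbhs (1 : G) U ->
  nbhs (1 : group_reflexion G)
    [set z : group_reflexion G |
      exists a b c : G, [/\ U a, U b, U c & z = a * b^-1 * c]].
Proof.
move=> [n n3 oG] U1; have U11 : U 1 := nbhs_singleton U1.
apply: filterS (oG U U1) => z.
case: n n3 {oG} => [|[|[|[|n]]]] //= _.
- by move=> [_ -> [a Ua <-]]; exists 1, 1, a; rewrite invg1 mulg1.
- move=> [_ [_ -> [a Ua <-]] [_ [b Ub <-] <-]]; exists a, b, 1.
  by rewrite mul1g mulg1.
- move=> [_ [_ [_ -> [a Ua <-]] [_ [b Ub <-] <-]] [c Uc <-]].
  by exists a, b, c; rewrite mul1g.
Qed.

(** Rewriting [y^-1 x = a b^-1 c] as [x b = (x c x^-1) y a] trades the inverses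
for a conjugation by [x]. The set [W] that [a], [b] and [c] range over depends
on [x] and on the neighborhood [N] of [x] to be met, but [V] does not. *)
Lemma closure_reflexion_sub (G : paratopologicalGroupType) (A V : set G) :
  oscillating 3 G -> nbhs (1 : G) V ->
  forall x : G, closure (A : set (group_reflexion G)) x ->
    closure [set z : G | exists v y w : G, [/\ V v, A y, V w & z = v * y * w]] x.
Proof.
move=> oG V1 x Ax N Nx.
pose W := V `&` [set c : G | V (x * c * x^-1)] `&` [set b : G | N (x * b)].
have W1 : nbhs (1 : G) W.
  apply: filterI; first apply: filterI => //.
  - have : (x * c * x^-1) @[c --> (1 : G)] --> x * 1 * x^-1.
      by apply: cvg_mulg (cvg_cst _); apply: cvg_mulg (cvg_cst _) cvg_id.
    by rewrite mulg1 mulgV; apply.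
  - have : (x * b) @[b --> (1 : G)] --> x * 1.
      exact: cvg_mulg (cvg_cst _) cvg_id.
    by rewrite mulg1; apply.
(* The same point, typed so that limits at it are taken in the reflexion. *)
pose h : group_reflexion G := x.
have : (y^-1 * h) @[y --> h] --> h^-1 * h.
  exact: cvg_mulVg cvg_id (cvg_cst _).
rewrite mulVg => /(_ _ (oscillating3_nbhs oG W1)) /Ax.
move=> [y [Ay [a [b [c [[[Va _] _] [_ Nb] [[_ Vc] _] yE]]]]]].
exists (x * b); split => //.
exists (x * c * x^-1), y, a; split => //.
have -> : a = y^-1 * x * c^-1 * b.
  by rewrite (yE : (y : G)^-1 * x = _) mulgK mulgVK.
by rewrite !mulgA mulgK mulgVK mulgK.
Qed.

(** A continuous division turns two points of a topological group without
disjoint neighborhoods into a point whose neighborhoods all contain the unit. *)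
Lemma hausdorff_closure1 (G : topologicalGroupType) :
  closure [set (1 : G)] `<=` [set 1] -> hausdorff_space G.
Proof.
move=> cl1 p q pq; suff pq1 : p^-1 * q = 1 by rewrite -(mulVKg p q) pq1 mulg1.
apply: cl1 => N.
have : (z.1^-1 * z.2) @[z --> (p, q)] --> p^-1 * q.
  by apply: cvg_mulVg; [exact: cvg_fst | exact: cvg_snd].
move=> /(_ N) /[apply] -[[A B] /= [Ap Bq] ABN].
have [z [Az Bz]] := pq A B Ap Bq.
by exists 1; split => //; rewrite -(mulVg z); apply: (ABN (z, z)).
Qed.

Theorem theorem3 (G : paratopologicalGroupType) :
  hausdorff_space G -> oscillating 3 G ->
  flat_separated G /\ (regular_space G -> flat_regular G).
Proof.
move=> hG oG; split=> [|rG U U1].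
- apply: hausdorff_closure1 => x x1; apply/esym/hG => W B W1 Bx.
  have [V V1 VW] := nbhs1_mulg2 W1.
  have [_ [[v [_ [w [Vv -> Vw ->]]]] Bvw]] := closure_reflexion_sub oG V1 x1 Bx.
  by exists (v * 1 * w); split => //; rewrite mulg1; apply: VW.
- have [W W1 WU] := rG 1 U U1.
  have [V V1 VW] := nbhs1_mulg3 W1.
  exists (closure (V : set (group_reflexion G))); split.
  + by apply: filterS V1; exact: (@subset_closure (group_reflexion G)).
  + exact: (@closed_closure (group_reflexion G)).
  + move=> x /(closure_reflexion_sub oG V1) Vx; apply: WU.
    apply: closureS Vx => _ [v [y [w [Vv Vy Vw ->]]]]; exact: VW.
Qed.
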